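(* Let $\sigma = \exists x\,\sigma_0(x)$ be a pure 1-$\Sigma_1$-sentence and let $\sigma^{\mathsf{cert}} := \exists x\,(\mathsf{cert}(x) \wedge \sigma_0(x))$. Then: (1) $\sigma^{\mathsf{cert}} \vdash \sigma$; (2) if $\mathbb{N} \models \sigma$, then $\mathsf{R}_0 \vdash \sigma^{\mathsf{cert}}$; (3) if $\mathbb{N} \models \neg\sigma$, then $\sigma^{\mathsf{cert}} \vdash \mathsf{R}_0$.
   Context: $\mathbb{L}_{\sf a}$ is the signature $\{0, \mathsf{S}, +, \times, \leq\}$ with $\leq$ primitive; $\overline{n}$ is the $n$-th numeral. $\mathsf{R}_0$ is the $\mathbb{L}_{\sf a}$-theory with axioms, for all $m,n\in\omega$: $\overline{m}+\overline{n} = \overline{m+n}$; $\overline{m}\times\overline{n} = \overline{m\times n}$; $\overline{m}\neq\overline{n}$ if $m\neq n$; $\forall x\,(x\leq\overline{n}\to\bigvee_{i\leq n}x=\overline{i})$; $\overline{m}\leq\overline{n}$ if $m\leq n$. $x<y$ abbreviates $x\leq y\wedge x\neq y$. A pure $\Delta_0$-formula is a bounded-quantifier formula in which every atomic $t_1\leq t_2$ has $t_1,t_2$ variables and every atomic $t_1=t_2$ is of one of the forms $x_0=x_1$, $0=x_0$, $\mathsf{S}x_0=x_1$, $x_0+x_1=x_2$, $x_0\times x_1=x_2$ ($x_i$ variables). A pure 1-$\Sigma_1$-sentence is $\exists x\,\sigma_0(x)$ with $\sigma_0$ pure $\Delta_0$. $\mathsf{cert}(v)$ is the conjunction of: A1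 $0\leq v$; A2 $\forall x<v\;\mathsf{S}x\leq v$; A3 $\forall x\,(x\leq 0\leftrightarrow x=0)$; A4 $\forall x<v\,\forall y\,(y\leq\mathsf{S}x\leftrightarrow(y\leq x\vee y=\mathsf{S}x))$; A5 $\forall x,y,z\leq v\;\mathsf{S}((x\times y)+z)\neq 0$; A6 $\forall x,y,z,w\leq v\;(\mathsf{S}((x\times y)+z)=\mathsf{S}w\to(x\times y)+z=w)$; A7 $\forall x,y\leq v\;(x\times y)+0=x\times y$; A8 $\forall x,y,z\leq v\;(x\times y)+\mathsf{S}z=\mathsf{S}((x\times y)+z)$; A9 $\forall x\leq v\;x\times 0=0$; A10 $\forall x,y\leq v\;x\times\mathsf{S}y=(x\times y)+x$. *)

(* Defs.v *)
From Stdlib Require Import List Arith.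
Import ListNotations.

(* First-order syntax over {0, S, +, *, <=}, with de Bruijn indices:
   [tvar n] is bound by the n-th enclosing quantifier, counted from the inside. *)

Inductive term : Type :=
| tvar (n : nat)
| tzero
| tsucc (t : term)
| tadd (t u : term)
| tmul (t u : term).

Inductive form : Type :=
| fEq (t u : term)
| fLe (t u : term)
| fBot
| fImp (A B : form)
| fAnd (A B : form)
| fOr (A B : form)
| fAll (A : form)
| fEx (A : form).

Definition fNot (A : form) : form := fImp A fBot.
Definition fIff (A B : form) : form := fAnd (fImp A B) (fImp B A).
Definition fLt (t u : term) : form := fAnd (fLe t u) (fNot (fEq t u)).

Fixpoint num (n : nat) : term :=
  match n with
  | 0 => tzero
  | S n => tsucc (num n)
  end.

Fixpoint tsubst (s : nat -> term) (t : term) : term :=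
  match t with
  | tvar n => s n
  | tzero => tzero
  | tsucc t => tsucc (tsubst s t)
  | tadd t u => tadd (tsubst s t) (tsubst s u)
  | tmul t u => tmul (tsubst s t) (tsubst s u)
  end.

Definition tlift (t : term) : term := tsubst (fun n => tvar (S n)) t.

Definition up (s : nat -> term) (n : nat) : term :=
  match n with
  | 0 => tvar 0
  | S n => tlift (s n)
  end.

Fixpoint fsubst (s : nat -> term) (A : form) : form :=
  match A with
  | fEq t u => fEq (tsubst s t) (tsubst s u)
  | fLe t u => fLe (tsubst s t) (tsubst s u)
  | fBot => fBot
  | fImp A B => fImp (fsubst s A) (fsubst s B)
  | fAnd A B => fAnd (fsubst s A) (fsubst s B)
  | fOr A B => fOr (fsubst s A) (fsubst s B)
  | fAll A => fAll (fsubst (up s) A)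
  | fEx A => fEx (fsubst (up s) A)
  end.

Definition flift (A : form) : form := fsubst (fun n => tvar (S n)) A.

(* A[t/x] for the variable x of index 0; the other indices go down by one. *)
Definition inst (A : form) (t : term) : form :=
  fsubst (fun n => match n with 0 => t | S n => tvar n end) A.

Fixpoint tbelow (k : nat) (t : term) : Prop :=
  match t with
  | tvar n => n < k
  | tzero => True
  | tsucc t => tbelow k t
  | tadd t u | tmul t u => tbelow k t /\ tbelow k u
  end.

(* All free variables have index < k. *)
Fixpoint fbelow (k : nat) (A : form) : Prop :=
  match A with
  | fEq t u | fLe t u => tbelow k t /\ tbelow k u
  | fBot => True
  | fImp A B | fAnd A B | fOr A B => fbelow k A /\ fbelow k B
  | fAll A | fEx A => fbelow (S k) A
  end.

Definition sentence (A : form) : Prop := fbelow 0 A.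

(* Natural deduction for classical first-order logic with equality. *)
Inductive prv : list form -> form -> Prop :=
| prv_hyp G A : In A G -> prv G A
| prv_botE G A : prv G fBot -> prv G A
| prv_raa G A : prv (fNot A :: G) fBot -> prv G A
| prv_impI G A B : prv (A :: G) B -> prv G (fImp A B)
| prv_impE G A B : prv G (fImp A B) -> prv G A -> prv G B
| prv_andI G A B : prv G A -> prv G B -> prv G (fAnd A B)
| prv_andE1 G A B : prv G (fAnd A B) -> prv G A
| prv_andE2 G A B : prv G (fAnd A B) -> prv G B
| prv_orI1 G A B : prv G A -> prv G (fOr A B)
| prv_orI2 G A B : prv G B -> prv G (fOr A B)
| prv_orE G A B C :
    prv G (fOr A B) -> prv (A :: G) C -> prv (B :: G) C -> prv G C
| prv_allI G A : prv (map flift G) A -> prv G (fAll A)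
| prv_allE G A t : prv G (fAll A) -> prv G (inst A t)
| prv_exI G A t : prv G (inst A t) -> prv G (fEx A)
| prv_exE G A C :
    prv G (fEx A) -> prv (A :: map flift G) (flift C) -> prv G C
| prv_eqI G t : prv G (fEq t t)
| prv_eqE G A t u : prv G (fEq t u) -> prv G (inst A t) -> prv G (inst A u).

Definition theory : Type := form -> Prop.

Definition proves (T : theory) (A : form) : Prop :=
  exists G : list form, (forall B, In B G -> T B) /\ prv G A.

Definition proves_theory (T U : theory) : Prop := forall A, U A -> proves T A.

Definition axiom (A : form) : theory := fun B => B = A.

(* Satisfaction in the standard model. *)
Fixpoint teval (r : nat -> nat) (t : term) : nat :=
  match t with
  | tvar n => r n
  | tzero => 0
  | tsucc t => S (teval r t)
  | tadd t u => teval r t + teval r u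
  | tmul t u => teval r t * teval r u
  end.

Definition scons (a : nat) (r : nat -> nat) (n : nat) : nat :=
  match n with
  | 0 => a
  | S n => r n
  end.

Fixpoint sat (r : nat -> nat) (A : form) : Prop :=
  match A with
  | fEq t u => teval r t = teval r u
  | fLe t u => teval r t <= teval r u
  | fBot => False
  | fImp A B => sat r A -> sat r B
  | fAnd A B => sat r A /\ sat r B
  | fOr A B => sat r A \/ sat r B
  | fAll A => forall a : nat, sat (scons a r) A
  | fEx A => exists a : nat, sat (scons a r) A
  end.

Definition Nmodels (A : form) : Prop := forall r : nat -> nat, sat r A.

(* [bigor f n] is the disjunction of f 0, ..., f n (both ends included). *)
Fixpoint bigor (f : nat -> form) (n : nat) : form :=
  match n with
  | 0 => f 0
  | S m => fOr (bigor f m) (f (S m))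
  end.

Inductive R0 : theory :=
| R0_add m n : R0 (fEq (tadd (num m) (num n)) (num (m + n)))
| R0_mul m n : R0 (fEq (tmul (num m) (num n)) (num (m * n)))
| R0_neq m n : m <> n -> R0 (fNot (fEq (num m) (num n)))
| R0_bound n :
    R0 (fAll (fImp (fLe (tvar 0) (num n))
                   (bigor (fun i => fEq (tvar 0) (num i)) n)))
| R0_le m n : m <= n -> R0 (fLe (num m) (num n)).

(* Bounded quantifiers: the bound [t] lives outside the quantifier, so it is
   lifted and cannot contain the quantified variable. *)
Definition fAllLe (t : term) (A : form) : form :=
  fAll (fImp (fLe (tvar 0) (tlift t)) A).
Definition fExLe (t : term) (A : form) : form :=
  fEx (fAnd (fLe (tvar 0) (tlift t)) A).
Definition fAllLt (t : term) (A : form) : form :=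
  fAll (fImp (fLt (tvar 0) (tlift t)) A).
Definition fExLt (t : term) (A : form) : form :=
  fEx (fAnd (fLt (tvar 0) (tlift t)) A).

Inductive delta0 : form -> Prop :=
| delta0_eq t u : delta0 (fEq t u)
| delta0_le t u : delta0 (fLe t u)
| delta0_bot : delta0 fBot
| delta0_imp A B : delta0 A -> delta0 B -> delta0 (fImp A B)
| delta0_and A B : delta0 A -> delta0 B -> delta0 (fAnd A B)
| delta0_or A B : delta0 A -> delta0 B -> delta0 (fOr A B)
| delta0_allLe t A : delta0 A -> delta0 (fAllLe t A)
| delta0_exLe t A : delta0 A -> delta0 (fExLe t A)
| delta0_allLt t A : delta0 A -> delta0 (fAllLt t A)
| delta0_exLt t A : delta0 A -> delta0 (fExLt t A).

Inductive pure_eq : term -> term -> Prop :=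
| pure_eq_var i j : pure_eq (tvar i) (tvar j)
| pure_eq_zero i : pure_eq tzero (tvar i)
| pure_eq_succ i j : pure_eq (tsucc (tvar i)) (tvar j)
| pure_eq_add i j k : pure_eq (tadd (tvar i) (tvar j)) (tvar k)
| pure_eq_mul i j k : pure_eq (tmul (tvar i) (tvar j)) (tvar k).

Inductive pure_le : term -> term -> Prop :=
| pure_le_var i j : pure_le (tvar i) (tvar j).

(* Every atomic subformula is pure, the bounds of bounded quantifiers
   included; so these bounds are variables. *)
Fixpoint pure_atoms (A : form) : Prop :=
  match A with
  | fEq t u => pure_eq t u
  | fLe t u => pure_le t u
  | fBot => True
  | fImp A B | fAnd A B | fOr A B => pure_atoms A /\ pure_atoms B
  | fAll A | fEx A => pure_atoms A
  end.

Definition pure_delta0 (A : form) : Prop := delta0 A /\ pure_atoms A.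

Definition pure_1Sigma1_sentence (A : form) : Prop :=
  sentence A /\ exists A0 : form, A = fEx A0 /\ pure_delta0 A0.

(* cert(v), with v the variable of index 0. Under k quantifiers v has index k,
   and the variables x, y, z, w introduced in this order have indices
   k-1, k-2, ... *)
Definition cert_A1 : form := fLe tzero (tvar 0).
Definition cert_A2 : form := fAllLt (tvar 0) (fLe (tsucc (tvar 0)) (tvar 1)).
Definition cert_A3 : form :=
  fAll (fIff (fLe (tvar 0) tzero) (fEq (tvar 0) tzero)).
Definition cert_A4 : form :=
  fAllLt (tvar 0)
    (fAll (fIff (fLe (tvar 0) (tsucc (tvar 1)))
                (fOr (fLe (tvar 0) (tvar 1)) (fEq (tvar 0) (tsucc (tvar 1)))))).
Definition cert_A5 : form :=
  fAllLe (tvar 0) (fAllLe (tvar 1) (fAllLe (tvar 2)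
    (fNot (fEq (tsucc (tadd (tmul (tvar 2) (tvar 1)) (tvar 0))) tzero)))).
Definition cert_A6 : form :=
  fAllLe (tvar 0) (fAllLe (tvar 1) (fAllLe (tvar 2) (fAllLe (tvar 3)
    (fImp (fEq (tsucc (tadd (tmul (tvar 3) (tvar 2)) (tvar 1)))
               (tsucc (tvar 0)))
          (fEq (tadd (tmul (tvar 3) (tvar 2)) (tvar 1)) (tvar 0)))))).
Definition cert_A7 : form :=
  fAllLe (tvar 0) (fAllLe (tvar 1)
    (fEq (tadd (tmul (tvar 1) (tvar 0)) tzero) (tmul (tvar 1) (tvar 0)))).
Definition cert_A8 : form :=
  fAllLe (tvar 0) (fAllLe (tvar 1) (fAllLe (tvar 2)
    (fEq (tadd (tmul (tvar 2) (tvar 1)) (tsucc (tvar 0)))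
         (tsucc (tadd (tmul (tvar 2) (tvar 1)) (tvar 0)))))).
Definition cert_A9 : form :=
  fAllLe (tvar 0) (fEq (tmul (tvar 0) tzero) tzero).
Definition cert_A10 : form :=
  fAllLe (tvar 0) (fAllLe (tvar 1)
    (fEq (tmul (tvar 1) (tsucc (tvar 0)))
         (tadd (tmul (tvar 1) (tvar 0)) (tvar 1)))).

Definition cert : form :=
  fAnd cert_A1 (fAnd cert_A2 (fAnd cert_A3 (fAnd cert_A4 (fAnd cert_A5
    (fAnd cert_A6 (fAnd cert_A7 (fAnd cert_A8 (fAnd cert_A9 cert_A10)))))))).

(* Main.v *)
(** The point of [cert v] is that [v] certifies arithmetic below itself: as long
    as the numerals up to [n] lie below [v], it proves the finite fragment
    [R0_upto n] of R0, and this fragment decides every pure Delta_0 formula whose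
    parameters are at most [n].  If [sigma] is true with witness [a], then R0
    evaluates both [sigma0 a] and [cert a].  If [sigma] is false, then
    [cert v /\ sigma0 v] refutes [v = n] for each [n] in turn, because
    [R0_upto n] already refutes [sigma0 n]; thus [n < v], hence [n + 1 <= v] by
    A2.  So [v] lies above all numerals and all of R0 follows. *)

Require Import Defs.
From Stdlib Require Import List Arith Lia.
Import ListNotations.

(** * Substitution *)

Lemma tsubst_ext s s' t : (forall n, s n = s' n) -> tsubst s t = tsubst s' t.
Proof. intros H; induction t; cbn; congruence. Qed.

Lemma tsubst_comp s s' t :
  tsubst s' (tsubst s t) = tsubst (fun n => tsubst s' (s n)) t.
Proof. induction t; cbn; congruence. Qed.

Lemma tsubst_var t : tsubst tvar t = t.
Proof. induction t; cbn; congruence. Qed.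

Lemma tsubst_num s n : tsubst s (num n) = num n.
Proof. induction n; cbn; congruence. Qed.

Lemma tlift_num n : tlift (num n) = num n.
Proof. apply tsubst_num. Qed.

Lemma tsubst_ext_below k s s' t :
  tbelow k t -> (forall n, n < k -> s n = s' n) -> tsubst s t = tsubst s' t.
Proof. intros Ht H; induction t; cbn in *; try f_equal; intuition. Qed.

Lemma fsubst_ext_below A : forall k s s',
  fbelow k A -> (forall n, n < k -> s n = s' n) -> fsubst s A = fsubst s' A.
Proof.
  assert (Hup : forall k s s', (forall n, n < k -> s n = s' n) ->
            forall n, n < S k -> up s n = up s' n).
  { intros k s s' H [|n] Hn; cbn; auto. rewrite H by lia; auto. }
  induction A; intros k s s' HA H; cbn in *; f_equal;
    try (eapply tsubst_ext_below; intuition eauto; fail); intuition eauto.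
Qed.

Lemma fsubst_ext A : forall s s', (forall n, s n = s' n) -> fsubst s A = fsubst s' A.
Proof.
  assert (Hup : forall s s', (forall n, s n = s' n) -> forall n, up s n = up s' n).
  { intros s s' H [|n]; cbn; congruence. }
  induction A; intros s s' H; cbn; f_equal; auto using tsubst_ext.
Qed.

Lemma fsubst_var A : fsubst tvar A = A.
Proof.
  assert (Hup : forall n, up tvar n = tvar n) by (intros [|n]; reflexivity).
  induction A; cbn; f_equal; auto using tsubst_var;
    rewrite (fsubst_ext _ _ _ Hup); auto.
Qed.

Lemma fsubst_comp A : forall s s',
  fsubst s' (fsubst s A) = fsubst (fun n => tsubst s' (s n)) A.
Proof.
  assert (Hup : forall s s' n,
            tsubst (up s') (up s n) = up (fun n => tsubst s' (s n)) n).
  { intros s s' [|n]; cbn; auto. unfold tlift; rewrite !tsubst_comp; auto. }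
  induction A; intros s s'; cbn; f_equal; auto using tsubst_comp;
    rewrite IHA; apply fsubst_ext; auto.
Qed.

Lemma inst_up s A t :
  inst (fsubst (up s) A) t = fsubst (fun n => match n with 0 => t | S n => s n end) A.
Proof.
  unfold inst; rewrite fsubst_comp; apply fsubst_ext; intros [|n]; cbn; auto.
  unfold tlift; rewrite tsubst_comp. apply tsubst_var.
Qed.

(** What [flift] does to the body of a quantifier. [lift_under B = B] expresses that no index other
    than 0 is free in [B]. *)
Definition lift_under (A : form) : form := fsubst (up (fun n => tvar (S n))) A.

Lemma inst_lift_under A : inst (lift_under A) (tvar 0) = A.
Proof.
  unfold lift_under; rewrite inst_up, <- (fsubst_var A) at 1.
  rewrite fsubst_comp; rewrite <- (fsubst_var A) at 2.
  apply fsubst_ext; intros [|n]; reflexivity.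
Qed.

Lemma inst_closed_tvar B : lift_under B = B -> inst B (tvar 0) = B.
Proof. intros H; rewrite <- H at 1; apply inst_lift_under. Qed.

Lemma tsubst_inst_tlift t u :
  tsubst (fun n => match n with 0 => u | S n => tvar n end) (tlift t) = t.
Proof. unfold tlift; rewrite tsubst_comp; apply tsubst_var. Qed.

Lemma fsubst_bigor s f n : fsubst s (bigor f n) = bigor (fun i => fsubst s (f i)) n.
Proof. induction n; cbn; congruence. Qed.

Lemma bigor_ext f g n : (forall i, f i = g i) -> bigor f n = bigor g n.
Proof. intros H; induction n; cbn; congruence. Qed.

(** * Derivations from a theory and a context *)

Lemma prv_weaken G A : prv G A -> forall G', incl G G' -> prv G' A.
Proof.
  induction 1; intros G' HG.
  - apply prv_hyp; auto.
  - apply prv_botE; auto.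
  - apply prv_raa, IHprv, incl_cons; [left; auto | apply incl_tl; auto].
  - apply prv_impI, IHprv, incl_cons; [left; auto | apply incl_tl; auto].
  - eapply prv_impE; eauto.
  - apply prv_andI; auto.
  - eapply prv_andE1; eauto.
  - eapply prv_andE2; eauto.
  - apply prv_orI1; auto.
  - apply prv_orI2; auto.
  - eapply prv_orE; [eauto | apply IHprv2 | apply IHprv3];
      (apply incl_cons; [left; auto | apply incl_tl; auto]).
  - apply prv_allI, IHprv, incl_map; auto.
  - apply prv_allE; auto.
  - eapply prv_exI; eauto.
  - eapply prv_exE; [eauto | apply IHprv2].
    apply incl_cons; [left; auto | apply incl_tl, incl_map; auto].
  - apply prv_eqI.
  - eapply prv_eqE; eauto.
Qed.

(** The axioms in use are kept apart from the local hypotheses [G], so that the quantifier rules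
    have to lift only [G]. *)
Definition prvT (T : theory) (G : list form) (A : form) : Prop :=
  exists D, (forall B, In B D -> T B) /\ prv (G ++ D) A.

(** A syntactic stand-in for having only sentences as axioms: the eigenvariable condition then never
    concerns the axioms. *)
Definition lift_stable (T : theory) : Prop := forall A, T A -> flift A = A.

Lemma prvT_weaken T G G' A : incl G G' -> prvT T G A -> prvT T G' A.
Proof.
  intros HG (D & HD & H); exists D; split; auto.
  eapply prv_weaken; eauto using incl_app, incl_appl, incl_appr, incl_refl.
Qed.

Lemma prvT_nil T G A : prvT T [] A -> prvT T G A.
Proof. apply prvT_weaken; intros B []. Qed.

Lemma prvT_mono (T U : theory) G A : (forall B, T B -> U B) -> prvT T G A -> prvT U G A.
Proof. intros H (D & HD & HA); exists D; auto. Qed.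

Lemma prvT_map2 T G A B C :
  (forall G', incl G G' -> prv G' A -> prv G' B -> prv G' C) ->
  prvT T G A -> prvT T G B -> prvT T G C.
Proof.
  intros H (D & HD & HA) (E & HE & HB); exists (D ++ E); split.
  - intros F HF; apply in_app_or in HF; firstorder.
  - apply H; [apply incl_appl, incl_refl | |];
      eapply prv_weaken; eauto; intros F HF; rewrite !in_app_iff in *; tauto.
Qed.

Lemma prvT_map T G A B : (forall G', prv G' A -> prv G' B) -> prvT T G A -> prvT T G B.
Proof. intros H (D & HD & HA); exists D; auto. Qed.

Lemma prvT_ax (T : theory) G A : T A -> prvT T G A.
Proof.
  intros H; exists [A]; split.
  - intros B [<-|[]]; auto.
  - apply prv_hyp, in_or_app; right; left; auto.
Qed.

Lemma prvT_hyp T G A : In A G -> prvT T G A.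
Proof.
  intros H; exists []; split; [intros B [] | apply prv_hyp, in_or_app; auto].
Qed.

Lemma prvT_impI T G A B : prvT T (A :: G) B -> prvT T G (fImp A B).
Proof. intros (D & HD & H); exists D; split; auto; apply prv_impI; auto. Qed.

Lemma prvT_impE T G A B : prvT T G (fImp A B) -> prvT T G A -> prvT T G B.
Proof. apply prvT_map2; intros; eapply prv_impE; eauto. Qed.

Lemma prvT_botE T G A : prvT T G fBot -> prvT T G A.
Proof. apply prvT_map; intros; apply prv_botE; auto. Qed.

Lemma prvT_andI T G A B : prvT T G A -> prvT T G B -> prvT T G (fAnd A B).
Proof. apply prvT_map2; intros; apply prv_andI; auto. Qed.

Lemma prvT_andE1 T G A B : prvT T G (fAnd A B) -> prvT T G A.
Proof. apply prvT_map; intros; eapply prv_andE1; eauto. Qed.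

Lemma prvT_andE2 T G A B : prvT T G (fAnd A B) -> prvT T G B.
Proof. apply prvT_map; intros; eapply prv_andE2; eauto. Qed.

Lemma prvT_orI1 T G A B : prvT T G A -> prvT T G (fOr A B).
Proof. apply prvT_map; intros; apply prv_orI1; auto. Qed.

Lemma prvT_orI2 T G A B : prvT T G B -> prvT T G (fOr A B).
Proof. apply prvT_map; intros; apply prv_orI2; auto. Qed.

(** The three premises may use different axioms. The two branches become implications and are
    conjoined, so that [prvT_map2] can merge the axiom lists. *)
Lemma prvT_orE T G A B C :
  prvT T G (fOr A B) -> prvT T (A :: G) C -> prvT T (B :: G) C -> prvT T G C.
Proof.
  intros H HA HB. apply prvT_impI in HA, HB.
  pose proof (prvT_andI _ _ _ _ HA HB) as HAB. revert H HAB.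
  apply prvT_map2; intros G' _ H HAB.
  assert (W : forall F, prv (F :: G') (fAnd (fImp A C) (fImp B C)))
    by (intros F; eapply prv_weaken; [exact HAB | apply incl_tl, incl_refl]).
  eapply prv_orE; [exact H | |].
  - apply prv_impE with A; [eapply prv_andE1, W | apply prv_hyp; left; auto].
  - apply prv_impE with B; [eapply prv_andE2, W | apply prv_hyp; left; auto].
Qed.

Lemma map_flift_stable (T : theory) D :
  lift_stable T -> (forall B, In B D -> T B) -> map flift D = D.
Proof.
  intros HT HD. rewrite <- (map_id D) at 2. apply map_ext_in; auto.
Qed.

Lemma prvT_allI T G A : lift_stable T -> prvT T (map flift G) A -> prvT T G (fAll A).
Proof.
  intros HT (D & HD & H); exists D; split; auto; apply prv_allI.
  rewrite map_app, (map_flift_stable T D); auto.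
Qed.

Lemma prvT_allE T G A t : prvT T G (fAll A) -> prvT T G (inst A t).
Proof. apply prvT_map; intros; apply prv_allE; auto. Qed.

Lemma prvT_exI T G A t : prvT T G (inst A t) -> prvT T G (fEx A).
Proof. apply prvT_map; intros; eapply prv_exI; eauto. Qed.

Lemma prvT_exE T G A C : lift_stable T ->
  prvT T G (fEx A) -> prvT T (A :: map flift G) (flift C) -> prvT T G C.
Proof.
  intros HT (D & HD & HA) (E & HE & HC); exists (D ++ E); split.
  - intros F HF; apply in_app_or in HF; firstorder.
  - eapply prv_exE.
    + eapply prv_weaken; [exact HA|].
      intros F HF; rewrite !in_app_iff in *; tauto.
    + rewrite !map_app, (map_flift_stable T D), (map_flift_stable T E) by auto.
      eapply prv_weaken; [exact HC|].
      intros F HF; cbn in *; rewrite !in_app_iff in *; tauto.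
Qed.

Lemma prvT_eqI T G t : prvT T G (fEq t t).
Proof. exists []; split; [intros B [] | apply prv_eqI]. Qed.

Lemma prvT_eqE T G A t u :
  prvT T G (fEq t u) -> prvT T G (inst A t) -> prvT T G (inst A u).
Proof. apply prvT_map2; intros; eapply prv_eqE; eauto. Qed.

(** The finitely many axioms of [U] in use are discharged one by one as implications. No quantifier
    rule is involved, so [T] may have axioms with free variables. *)
Lemma prvT_cut (T U : theory) A :
  (forall B, U B -> prvT T [] B) -> prvT U [] A -> prvT T [] A.
Proof.
  intros HU (D & HD & HA); cbn in HA; revert A HA.
  induction D as [|B D IH]; intros A HA.
  - exists []; split; [intros B [] | auto].
  - apply prvT_impE with B; [|apply HU, HD; left; auto].
    apply IH; [intros; apply HD; right; auto | apply prv_impI; auto].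
Qed.

(** [A] is a context with a hole, and [A0] represents it as a formula whose hole is index 0; this is
    the form in which Leibniz's rule applies. *)
Lemma prvT_eq_rw T G (A : term -> form) A0 t u :
  (forall x, inst A0 x = A x) -> prvT T G (fEq t u) -> prvT T G (A t) -> prvT T G (A u).
Proof. intros H Htu; rewrite <- !H; apply prvT_eqE; auto. Qed.

Ltac inst_simpl := unfold inst; cbn; rewrite ?tsubst_inst_tlift; auto.

(** * Derived equality and congruence rules *)

Lemma prvT_eq_sym T G t u : prvT T G (fEq t u) -> prvT T G (fEq u t).
Proof.
  intros H; apply (prvT_eq_rw T G (fun x => fEq x t) (fEq (tvar 0) (tlift t)) t u);
    auto using prvT_eqI; intros; inst_simpl.
Qed.

Lemma prvT_eq_trans T G t u v :
  prvT T G (fEq t u) -> prvT T G (fEq u v) -> prvT T G (fEq t v).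
Proof.
  intros H H'; apply (prvT_eq_rw T G (fun x => fEq t x) (fEq (tlift t) (tvar 0)) u v);
    auto; intros; inst_simpl.
Qed.

Lemma prvT_eq_succ T G t u : prvT T G (fEq t u) -> prvT T G (fEq (tsucc t) (tsucc u)).
Proof.
  intros H; apply (prvT_eq_rw T G (fun x => fEq (tsucc t) (tsucc x))
    (fEq (tsucc (tlift t)) (tsucc (tvar 0))) t u);
    auto using prvT_eqI; intros; inst_simpl.
Qed.

Lemma prvT_eq_add T G t t' u u' : prvT T G (fEq t t') -> prvT T G (fEq u u') ->
  prvT T G (fEq (tadd t u) (tadd t' u')).
Proof.
  intros H H'.
  apply (prvT_eq_rw T G (fun x => fEq (tadd t u) (tadd t' x))
    (fEq (tadd (tlift t) (tlift u)) (tadd (tlift t') (tvar 0))) u u');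
    auto; [intros; inst_simpl|].
  apply (prvT_eq_rw T G (fun x => fEq (tadd t u) (tadd x u))
    (fEq (tadd (tlift t) (tlift u)) (tadd (tvar 0) (tlift u))) t t');
    auto using prvT_eqI; intros; inst_simpl.
Qed.

Lemma prvT_eq_mul T G t t' u u' : prvT T G (fEq t t') -> prvT T G (fEq u u') ->
  prvT T G (fEq (tmul t u) (tmul t' u')).
Proof.
  intros H H'.
  apply (prvT_eq_rw T G (fun x => fEq (tmul t u) (tmul t' x))
    (fEq (tmul (tlift t) (tlift u)) (tmul (tlift t') (tvar 0))) u u');
    auto; [intros; inst_simpl|].
  apply (prvT_eq_rw T G (fun x => fEq (tmul t u) (tmul x u))
    (fEq (tmul (tlift t) (tlift u)) (tmul (tvar 0) (tlift u))) t t');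
    auto using prvT_eqI; intros; inst_simpl.
Qed.

Lemma prvT_le_eq T G t u v :
  prvT T G (fEq t u) -> prvT T G (fLe t v) -> prvT T G (fLe u v).
Proof.
  intros H; apply (prvT_eq_rw T G (fun x => fLe x v) (fLe (tvar 0) (tlift v)));
    auto; intros; inst_simpl.
Qed.

Lemma prvT_neq T G t t' u u' : prvT T G (fEq t t') -> prvT T G (fEq u u') ->
  prvT T G (fNot (fEq t' u')) -> prvT T G (fNot (fEq t u)).
Proof.
  intros Ht Hu H; apply prvT_impI.
  assert (W : forall A, prvT T G A -> prvT T (fEq t u :: G) A)
    by (intros A; apply prvT_weaken, incl_tl, incl_refl).
  eapply prvT_impE; [apply W, H|].
  eapply prvT_eq_trans; [apply prvT_eq_sym, W, Ht|].
  eapply prvT_eq_trans; [apply prvT_hyp; left; auto | apply W, Hu].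
Qed.

Lemma prvT_bigorE T f C n : forall G,
  prvT T G (bigor f n) -> (forall i, i <= n -> prvT T (f i :: G) C) -> prvT T G C.
Proof.
  induction n; intros G H HC; cbn in H.
  - eapply prvT_impE; [apply prvT_impI, HC; auto | auto].
  - eapply prvT_orE; [exact H | | apply HC; auto].
    apply IHn; [apply prvT_hyp; left; auto|].
    intros i Hi; eapply prvT_weaken; [|apply (HC i); lia].
    apply incl_cons; [left; auto | apply incl_tl, incl_tl, incl_refl].
Qed.

(** * Bounded quantifiers *)

Definition bound_ax (n : nat) : form :=
  fAll (fImp (fLe (tvar 0) (num n)) (bigor (fun i => fEq (tvar 0) (num i)) n)).

Lemma prvT_bound T G k x : prvT T G (bound_ax k) -> prvT T G (fLe x (num k)) ->
  prvT T G (bigor (fun i => fEq x (num i)) k).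
Proof.
  intros Hk Hx; apply prvT_impE with (fLe x (num k)); auto.
  apply prvT_allE with (t := x) in Hk; unfold inst in Hk; cbn in Hk.
  rewrite fsubst_bigor, tsubst_num in Hk.
  erewrite bigor_ext; [exact Hk|]. intros; cbn; rewrite tsubst_num; auto.
Qed.

(** The bounding axiom turns [x] into one of finitely many numerals, and Leibniz's rule carries [B]
    from each of them to [x]. *)
Lemma prvT_bound_cases T G k x B :
  prvT T G (bound_ax k) -> prvT T G (fLe x (num k)) ->
  (forall i, i <= k -> prvT T G (inst B (num i))) -> prvT T G (inst B x).
Proof.
  intros Hk Hx HB. eapply prvT_bigorE; [apply prvT_bound; eauto|].
  intros i Hi; apply prvT_eqE with (num i).
  - apply prvT_eq_sym, prvT_hyp; left; auto.
  - eapply prvT_weaken; [apply incl_tl, incl_refl | auto].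
Qed.

(** The guard [g] is abstract, and is only required to imply that the variable is at most [k]; this
    treats the bounds by [fLe] and by [fLt] alike. *)
Lemma prvT_all_guarded T k g A : lift_stable T ->
  lift_under (fImp g A) = fImp g A -> prvT T [] (bound_ax k) ->
  prvT T [g] (fLe (tvar 0) (num k)) ->
  (forall i, i <= k -> prvT T [] (inst (fImp g A) (num i))) ->
  prvT T [] (fAll (fImp g A)).
Proof.
  intros HT HB Hk Hg HA; apply prvT_allI, prvT_impI; auto; cbn.
  apply prvT_impE with g; [|apply prvT_hyp; left; auto].
  rewrite <- (inst_closed_tvar _ HB).
  apply prvT_bound_cases with k; auto using prvT_nil.
Qed.

Lemma prvT_ex_guarded T k g A : lift_stable T ->
  lift_under (fAnd g A) = fAnd g A -> prvT T [] (bound_ax k) ->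
  prvT T [g] (fLe (tvar 0) (num k)) ->
  (forall i, i <= k -> prvT T [] (fNot (inst (fAnd g A) (num i)))) ->
  prvT T [] (fNot (fEx (fAnd g A))).
Proof.
  intros HT HB Hk Hg HA; apply prvT_impI.
  eapply prvT_exE; auto; [apply prvT_hyp; left; reflexivity|].
  change (flift fBot) with fBot.
  set (G := fAnd g A :: _).
  assert (HG : prvT T G (fAnd g A)) by (apply prvT_hyp; left; auto).
  apply prvT_impE with (fAnd g A); auto.
  change (prvT T G (fNot (fAnd g A))).
  rewrite <- (inst_closed_tvar _ HB).
  change (prvT T G (inst (fNot (fAnd g A)) (tvar 0))).
  apply prvT_bound_cases with k.
  - apply prvT_nil; auto.
  - apply prvT_impE with g; [|eapply prvT_andE1; eauto].
    apply prvT_nil, prvT_impI; auto.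
  - intros i Hi; apply prvT_nil, HA; auto.
Qed.

(** * Finite fragments of R0 and pure Delta_0 formulas *)

(* The bound on [m] in [R0_upto_neq] is what A5 and A6 yield: they apply to
   successors of values of [x * y + z] with [x], [y], [z] at most [n]. *)
Inductive R0_upto (n : nat) : theory :=
| R0_upto_add i j : i <= n -> j <= n ->
    R0_upto n (fEq (tadd (num i) (num j)) (num (i + j)))
| R0_upto_mul i j : i <= n -> j <= n ->
    R0_upto n (fEq (tmul (num i) (num j)) (num (i * j)))
| R0_upto_neq m k : m <= S (n * n + n) -> k <= n -> m <> k ->
    R0_upto n (fNot (fEq (num m) (num k)))
| R0_upto_bound k : k <= n -> R0_upto n (bound_ax k)
| R0_upto_le i k : i <= k -> k <= n -> R0_upto n (fLe (num i) (num k)).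

Lemma R0_upto_R0 n A : R0_upto n A -> R0 A.
Proof. destruct 1; constructor; auto. Qed.

Lemma R0_R0_upto A : R0 A -> exists n, R0_upto n A.
Proof.
  destruct 1 as [m n|m n|m n H|n|m n H].
  - exists (m + n); constructor; lia.
  - exists (m + n); constructor; lia.
  - exists (m + n); constructor; auto; nia.
  - exists n; apply R0_upto_bound; auto.
  - exists n; constructor; auto.
Qed.

Lemma R0_lift_stable : lift_stable R0.
Proof.
  unfold lift_stable, flift; destruct 1; cbn; rewrite ?tsubst_num; auto.
  rewrite fsubst_bigor; do 2 f_equal.
  apply bigor_ext; intros; cbn; rewrite tsubst_num; auto.
Qed.

Lemma R0_upto_lift_stable n : lift_stable (R0_upto n).
Proof. intros A HA; apply R0_lift_stable; eapply R0_upto_R0; eauto. Qed.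

(** * Deciding pure Delta_0 formulas in a finite fragment *)

Definition numsubst (r : nat -> nat) (n : nat) : term := num (r n).

(** Truth in the standard model and provability are settled together, so no excluded middle for
    [sat] has to be assumed. *)
Definition decides (T : theory) (r : nat -> nat) (A : form) : Prop :=
  (sat r A /\ prvT T [] (fsubst (numsubst r) A)) \/
  (~ sat r A /\ prvT T [] (fNot (fsubst (numsubst r) A))).

Lemma inst_numsubst r A i :
  inst (fsubst (up (numsubst r)) A) (num i) = fsubst (numsubst (scons i r)) A.
Proof. rewrite inst_up; apply fsubst_ext; intros [|m]; reflexivity. Qed.

Lemma lift_under_numsubst r A :
  lift_under (fsubst (up (numsubst r)) A) = fsubst (up (numsubst r)) A.
Proof.
  unfold lift_under; rewrite fsubst_comp; apply fsubst_ext; intros [|m]; cbn; auto.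
  unfold numsubst; rewrite tlift_num, tsubst_num; auto.
Qed.

Lemma decides_imp T r A B : decides T r A -> decides T r B -> decides T r (fImp A B).
Proof.
  intros [[HA PA]|[HA PA]] [[HB PB]|[HB PB]]; unfold decides; cbn.
  - left; split; auto. apply prvT_impI, prvT_nil; auto.
  - right; split; auto. apply prvT_impI. eapply prvT_impE; [apply prvT_nil, PB|].
    eapply prvT_impE; [apply prvT_hyp; left; auto | apply prvT_nil, PA].
  - left; split; auto. apply prvT_impI, prvT_nil; auto.
  - left; split; [tauto|]. apply prvT_impI, prvT_botE.
    eapply prvT_impE; [apply prvT_nil, PA | apply prvT_hyp; left; auto].
Qed.

Lemma decides_and T r A B : decides T r A -> decides T r B -> decides T r (fAnd A B).
Proof.
  intros [[HA PA]|[HA PA]] [[HB PB]|[HB PB]]; unfold decides; cbn.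
  1: left; split; auto; apply prvT_andI; auto.
  all: right; split; [tauto|]; apply prvT_impI.
  1: eapply prvT_impE; [apply prvT_nil, PB|];
     eapply prvT_andE2, prvT_hyp; left; reflexivity.
  all: eapply prvT_impE; [apply prvT_nil, PA|];
       eapply prvT_andE1, prvT_hyp; left; reflexivity.
Qed.

Lemma decides_or T r A B : decides T r A -> decides T r B -> decides T r (fOr A B).
Proof.
  intros [[HA PA]|[HA PA]] [[HB PB]|[HB PB]]; unfold decides; cbn.
  1,2: left; split; auto; apply prvT_orI1; auto.
  - left; split; auto; apply prvT_orI2; auto.
  - right; split; [tauto|]. apply prvT_impI.
    eapply prvT_orE; [apply prvT_hyp; left; reflexivity | |].
    + eapply prvT_impE; [apply prvT_nil, PA | apply prvT_hyp; left; auto].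
    + eapply prvT_impE; [apply prvT_nil, PB | apply prvT_hyp; left; auto].
Qed.

Lemma decides_bot T r : decides T r fBot.
Proof. right; split; auto. apply prvT_impI, prvT_hyp; left; auto. Qed.

(** A constructive finite search: it yields either the universal claim or an explicit
    counterexample. *)
Lemma bounded_search (P Q : nat -> Prop) k : (forall i, i <= k -> P i \/ Q i) ->
  (forall i, i <= k -> P i) \/ exists i, i <= k /\ Q i.
Proof.
  induction k; intros H.
  - destruct (H 0) as [H0|H0]; auto; [left | right; eauto].
    intros i Hi; replace i with 0 by lia; auto.
  - destruct IHk as [IH|(i & Hi & HQ)]; [intros; apply H; lia | | right; eauto].
    destruct (H (S k)) as [HS|HS]; auto; [left | right; eauto].
    intros i Hi; destruct (Nat.eq_dec i (S k)) as [->|]; auto; apply IH; lia.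
Qed.

Lemma decides_all_guarded T r k g A : lift_stable T ->
  prvT T [] (bound_ax k) -> (forall i, sat (scons i r) g -> i <= k) ->
  prvT T [fsubst (up (numsubst r)) g] (fLe (tvar 0) (num k)) ->
  (forall i, i <= k -> decides T (scons i r) (fImp g A)) ->
  decides T r (fAll (fImp g A)).
Proof.
  intros HT Hk Hs Hg H; unfold decides in *.
  apply bounded_search in H; destruct H as [H|(i & Hi & Hsat & Hprv)].
  - left; split.
    + intros i Hgi. apply (H i); auto.
    + apply prvT_all_guarded with k; auto.
      * apply (lift_under_numsubst r (fImp g A)).
      * intros i Hi.
        change (prvT T [] (inst (fsubst (up (numsubst r)) (fImp g A)) (num i))).
        rewrite inst_numsubst; apply H; auto.
  - right; split.
    + intros Hall; exact (Hsat (Hall i)).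
    + apply prvT_impI. eapply prvT_impE; [apply prvT_nil, Hprv|].
      rewrite <- inst_numsubst; apply prvT_allE, prvT_hyp; left; auto.
Qed.

Lemma decides_ex_guarded T r k g A : lift_stable T ->
  prvT T [] (bound_ax k) -> (forall i, sat (scons i r) g -> i <= k) ->
  prvT T [fsubst (up (numsubst r)) g] (fLe (tvar 0) (num k)) ->
  (forall i, i <= k -> decides T (scons i r) (fAnd g A)) ->
  decides T r (fEx (fAnd g A)).
Proof.
  intros HT Hk Hs Hg H; unfold decides in *.
  (* The disjuncts are swapped so that the search looks for a true instance rather than a false
     one. *)
  assert (H' := fun i Hi => proj1 (or_comm _ _) (H i Hi)).
  apply bounded_search in H'; destruct H' as [H'|(i & Hi & Hsat & Hprv)].
  - right; split.
    + intros (i & Hgi & HAi). apply (H' i); [auto | split; auto].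
    + apply prvT_ex_guarded with k; auto.
      * apply (lift_under_numsubst r (fAnd g A)).
      * intros i Hi.
        change (prvT T [] (fNot (inst (fsubst (up (numsubst r)) (fAnd g A)) (num i)))).
        rewrite inst_numsubst; apply H'; auto.
  - left; split.
    + exists i; auto.
    + apply prvT_exI with (num i).
      change (prvT T [] (inst (fsubst (up (numsubst r)) (fAnd g A)) (num i))).
      rewrite inst_numsubst; auto.
Qed.

(** The two bounds differ because the left side of a pure equation may be a successor, sum or
    product of values up to [n], while the right side is a variable. *)
Lemma R0_upto_decides_numeral_eq n r t u a b :
  prvT (R0_upto n) [] (fEq (tsubst (numsubst r) t) (num a)) -> teval r t = a ->
  tsubst (numsubst r) u = num b -> teval r u = b ->
  a <= S (n * n + n) -> b <= n -> decides (R0_upto n) r (fEq t u).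
Proof.
  intros Ht Ht' Hu Hu' Ha Hb; unfold decides; cbn; rewrite Hu, Hu', Ht'.
  destruct (Nat.eq_dec a b) as [<-|Hab]; [left | right]; split; auto.
  eapply prvT_neq; [exact Ht | apply prvT_eqI|].
  apply prvT_ax; constructor; auto.
Qed.

Lemma R0_upto_decides_eq n r t u : (forall i, r i <= n) ->
  pure_eq t u -> decides (R0_upto n) r (fEq t u).
Proof.
  intros Hr []; eapply R0_upto_decides_numeral_eq; try reflexivity; auto; cbn.
  - apply prvT_eqI.
  - pose proof (Hr i); lia.
  - change tzero with (num 0); apply prvT_eqI.
  - lia.
  - change (tsucc (numsubst r i)) with (num (S (r i))); apply prvT_eqI.
  - pose proof (Hr i); lia.
  - apply prvT_ax; constructor; auto.
  - pose proof (Hr i); pose proof (Hr j); destruct n; nia.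
  - apply prvT_ax; constructor; auto.
  - pose proof (Hr i); pose proof (Hr j); nia.
Qed.

Lemma R0_upto_decides_le n r t u : (forall i, r i <= n) ->
  pure_le t u -> decides (R0_upto n) r (fLe t u).
Proof.
  intros Hr [i j]; unfold decides; cbn; unfold numsubst.
  destruct (le_lt_dec (r i) (r j)); [left | right]; split; try lia.
  - apply prvT_ax; constructor; auto.
  (* If [r i] exceeds [r j], the bounding axiom at [r j] would equate the numeral of [r i] with some
     smaller numeral. *)
  - apply prvT_impI. eapply prvT_bigorE.
    + apply prvT_bound; [apply prvT_ax, R0_upto_bound; auto | apply prvT_hyp; left; auto].
    + intros k Hk. eapply prvT_impE; [|apply prvT_hyp; left; auto].
      apply prvT_ax; constructor; try lia; auto.
      * pose proof (Hr i); lia.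
      * pose proof (Hr j); lia.
Qed.

Lemma pure_le_tlift t : pure_le (tvar 0) (tlift t) -> exists j, t = tvar j.
Proof. intros H; destruct t; inversion H; eauto. Qed.

(** Purity makes every quantifier bound a variable, hence of value at most [n]. The values met in
    the recursion therefore never exceed [n], and one fragment suffices throughout. *)
Lemma R0_upto_decides_delta0 n A : delta0 A -> pure_atoms A ->
  forall r, (forall i, r i <= n) -> decides (R0_upto n) r A.
Proof.
  assert (Hscons : forall r i k, (forall i, r i <= n) -> i <= r k ->
            forall j, scons i r j <= n).
  { intros r i k Hr Hi [|j]; cbn; auto. eapply Nat.le_trans; eauto. }
  induction 1; cbn [pure_atoms fAllLe fExLe fAllLt fExLt fLt fNot]; intros Hp r Hr.
  - apply R0_upto_decides_eq; auto.
  - apply R0_upto_decides_le; auto.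
  - apply decides_bot.
  - destruct Hp; apply decides_imp; auto.
  - destruct Hp; apply decides_and; auto.
  - destruct Hp; apply decides_or; auto.
  - destruct Hp as [Ht Hp]; destruct (pure_le_tlift _ Ht) as [k ->].
    apply decides_all_guarded with (r k); auto using R0_upto_lift_stable.
    + apply prvT_ax, R0_upto_bound; auto.
    + apply prvT_hyp; left; cbn; unfold numsubst; rewrite tlift_num; auto.
    + intros; apply decides_imp; eauto using R0_upto_decides_le.
  - destruct Hp as [Ht Hp]; destruct (pure_le_tlift _ Ht) as [k ->].
    apply decides_ex_guarded with (r k); auto using R0_upto_lift_stable.
    + apply prvT_ax, R0_upto_bound; auto.
    + apply prvT_hyp; left; cbn; unfold numsubst; rewrite tlift_num; auto.
    + intros; apply decides_and; eauto using R0_upto_decides_le.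
  - destruct Hp as [[Ht [He _]] Hp]; destruct (pure_le_tlift _ Ht) as [k ->].
    apply decides_all_guarded with (r k); auto using R0_upto_lift_stable.
    + apply prvT_ax, R0_upto_bound; auto.
    + intros i []; auto.
    + eapply prvT_andE1, prvT_hyp; left; cbn; unfold numsubst; rewrite tlift_num; reflexivity.
    + intros; apply decides_imp; eauto.
      (* The induction hypothesis covers only the body; the strict guard is decided from its two
         atoms. *)
      apply decides_and; [|apply decides_imp; [|apply decides_bot]];
        eauto using R0_upto_decides_le, R0_upto_decides_eq.
  - destruct Hp as [[Ht [He _]] Hp]; destruct (pure_le_tlift _ Ht) as [k ->].
    apply decides_ex_guarded with (r k); auto using R0_upto_lift_stable.
    + apply prvT_ax, R0_upto_bound; auto.
    + intros i []; auto.
    + eapply prvT_andE1, prvT_hyp; left; cbn; unfold numsubst; rewrite tlift_num; reflexivity.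
    + intros; apply decides_and; eauto.
      apply decides_and; [|apply decides_imp; [|apply decides_bot]];
        eauto using R0_upto_decides_le, R0_upto_decides_eq.
Qed.

(** * R0 proves the certificate of every numeral *)

Lemma tbelow_num n k : tbelow k (num n).
Proof. induction n; cbn; auto. Qed.

Lemma R0_eval r t : tbelow 0 t -> prvT R0 [] (fEq t (num (teval r t))).
Proof.
  induction t; cbn; intros H.
  - lia.
  - apply prvT_eqI.
  - apply prvT_eq_succ; auto.
  - destruct H. eapply prvT_eq_trans; [apply prvT_eq_add; auto|].
    apply prvT_ax; constructor.
  - destruct H. eapply prvT_eq_trans; [apply prvT_eq_mul; auto|].
    apply prvT_ax; constructor.
Qed.

Lemma R0_eq r t u : tbelow 0 t -> tbelow 0 u -> teval r t = teval r u ->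
  prvT R0 [] (fEq t u).
Proof.
  intros Ht Hu H. eapply prvT_eq_trans; [apply (R0_eval r); auto|].
  rewrite H; apply prvT_eq_sym, R0_eval; auto.
Qed.

Lemma R0_neq_eval r t u : tbelow 0 t -> tbelow 0 u -> teval r t <> teval r u ->
  prvT R0 [] (fNot (fEq t u)).
Proof.
  intros Ht Hu H. eapply prvT_neq; [apply (R0_eval r); auto | apply (R0_eval r); auto|].
  apply prvT_ax; constructor; auto.
Qed.

Lemma teval_num r n : teval r (num n) = n.
Proof. induction n; cbn; auto. Qed.

Lemma R0_allLe k A : lift_under A = A ->
  (forall i, i <= k -> prvT R0 [] (inst A (num i))) ->
  prvT R0 [] (fAll (fImp (fLe (tvar 0) (num k)) A)).
Proof.
  intros HA H; apply prvT_all_guarded with k; auto using R0_lift_stable.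
  - unfold lift_under in *; cbn; rewrite tsubst_num, HA; auto.
  - apply prvT_ax; constructor.
  - apply prvT_hyp; left; auto.
  - intros i Hi; apply prvT_impI, prvT_nil, H; auto.
Qed.

Lemma R0_allLt k A : lift_under A = A ->
  (forall i, i < k -> prvT R0 [] (inst A (num i))) ->
  prvT R0 [] (fAll (fImp (fLt (tvar 0) (num k)) A)).
Proof.
  intros HA H; apply prvT_all_guarded with k; auto using R0_lift_stable.
  - unfold lift_under in *; cbn; rewrite tsubst_num, HA; auto.
  - apply prvT_ax; constructor.
  - eapply prvT_andE1, prvT_hyp; left; reflexivity.
  - intros i Hi; apply prvT_impI.
    (* The enumeration includes [k] itself, where the strict guard contains the refutable
       [num k <> num k]. *)
    destruct (Nat.eq_dec i k) as [->|]; [|apply prvT_nil, H; lia].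
    apply prvT_botE. eapply prvT_impE; [eapply prvT_andE2, prvT_hyp; left; reflexivity|].
    cbn; rewrite tsubst_num; apply prvT_eqI.
Qed.

Definition le_zero_ax : form := fAll (fIff (fLe (tvar 0) tzero) (fEq (tvar 0) tzero)).

(** The instance of A4 at the numeral [k], with its guard removed. *)
Definition le_succ_ax (k : nat) : form :=
  fAll (fIff (fLe (tvar 0) (num (S k)))
             (fOr (fLe (tvar 0) (num k)) (fEq (tvar 0) (num (S k))))).

Lemma R0_le_zero : prvT R0 [] le_zero_ax.
Proof.
  apply prvT_allI; [apply R0_lift_stable|]; cbn. apply prvT_andI; apply prvT_impI.
  - apply (prvT_bound R0 _ 0); [apply prvT_ax, (R0_bound 0) | apply prvT_hyp; left; auto].
  - eapply prvT_le_eq; [apply prvT_eq_sym, prvT_hyp; left; reflexivity|].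
    apply prvT_ax, (R0_le 0 0); auto.
Qed.

Lemma R0_le_succ i : prvT R0 [] (le_succ_ax i).
Proof.
  apply prvT_allI; [apply R0_lift_stable|]; cbn. apply prvT_andI; apply prvT_impI.
  - eapply prvT_bigorE.
    + apply (prvT_bound R0 _ (S i)); [apply prvT_ax, (R0_bound (S i)) | apply prvT_hyp; left; auto].
    + intros j Hj; destruct (Nat.eq_dec j (S i)) as [->|].
      * apply prvT_orI2, prvT_hyp; left; auto.
      * apply prvT_orI1. eapply prvT_le_eq; [apply prvT_eq_sym, prvT_hyp; left; reflexivity|].
        apply prvT_ax; constructor; lia.
  - eapply prvT_orE; [apply prvT_hyp; left; reflexivity | |].
    + eapply prvT_bigorE.
      * apply (prvT_bound R0 _ i); [apply prvT_ax, (R0_bound i) | apply prvT_hyp; left; auto].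
      * intros j Hj. eapply prvT_le_eq; [apply prvT_eq_sym, prvT_hyp; left; reflexivity|].
        apply prvT_ax, (R0_le j (S i)); lia.
    + eapply prvT_le_eq; [apply prvT_eq_sym, prvT_hyp; left; reflexivity|].
      apply prvT_ax, (R0_le (S i) (S i)); lia.
Qed.

Ltac num_simpl := unfold inst, lift_under, tlift; cbn; rewrite ?tsubst_num; cbn.
Ltac num_simpl_in H := unfold inst, tlift in H; cbn in H; rewrite ?tsubst_num in H; cbn in H.

Ltac R0_bounded :=
  num_simpl;
  repeat (first [apply R0_allLe | apply R0_allLt];
          [num_simpl; reflexivity | intros ? ?; num_simpl]).

Ltac R0_atom :=
  first [apply (R0_eq (fun _ => 0)) | apply (R0_neq_eval (fun _ => 0))];
  cbn; rewrite ?teval_num; auto 10 using tbelow_num; try lia.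

Lemma R0_cert n : prvT R0 [] (inst cert (num n)).
Proof.
  repeat apply prvT_andI.
  - num_simpl; apply prvT_ax, (R0_le 0 n); lia.
  - R0_bounded. apply prvT_ax, (R0_le (S i) n); lia.
  - apply R0_le_zero.
  - R0_bounded. apply R0_le_succ.
  - R0_bounded. R0_atom.
  - R0_bounded.
    (* For A6: either the conclusion is true and hence provable, or the premise is false and hence
       refutable. *)
    destruct (Nat.eq_dec (i * i0 + i1) i2) as [E|E].
    + apply prvT_impI, prvT_nil; R0_atom.
    + apply prvT_impI, prvT_botE.
      eapply prvT_impE; [|apply prvT_hyp; left; reflexivity].
      apply prvT_nil; R0_atom.
  - R0_bounded. R0_atom.
  - R0_bounded. R0_atom.
  - R0_bounded. R0_atom.
  - R0_bounded. R0_atom.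
Qed.

(** * Arithmetic below a certified element *)

(* The certified element is the variable of index 0, which is free in [T]; so
   generalisation is done in closed contexts and transferred by [prvT_cut]. *)
Definition certified (T : theory) (n : nat) : Prop :=
  prvT T [] cert /\
  (forall k, k <= n -> prvT T [] (fLe (num k) (tvar 0))) /\
  (forall k, k < n -> prvT T [] (fNot (fEq (num k) (tvar 0)))).

Ltac cert_axiom H :=
  first [exact H | exact (prvT_andE1 _ _ _ _ H)
        | apply prvT_andE2 in H; cert_axiom H].

Ltac cert_inst H x :=
  apply prvT_allE with (t := x) in H; num_simpl_in H;
  lazymatch type of H with
  | prvT ?T ?G (fImp ?A ?B) =>
      assert (prvT T G B) by (apply (prvT_impE T G A B H); auto);
      clear H; lazymatch goal with H' : prvT T G B |- _ => rename H' into H end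
  end.

Lemma cert_A2_inst T k : prvT T [] cert ->
  prvT T [] (fLe (num k) (tvar 0)) -> prvT T [] (fNot (fEq (num k) (tvar 0))) ->
  prvT T [] (fLe (num (S k)) (tvar 0)).
Proof.
  intros Hc Hl Hn. assert (H : prvT T [] cert_A2) by cert_axiom Hc.
  apply prvT_allE with (t := num k) in H; num_simpl_in H.
  eapply prvT_impE; [exact H | apply prvT_andI; auto].
Qed.

Lemma cert_A4_inst T k : prvT T [] cert ->
  prvT T [] (fLe (num k) (tvar 0)) -> prvT T [] (fNot (fEq (num k) (tvar 0))) ->
  prvT T [] (le_succ_ax k).
Proof.
  intros Hc Hl Hn. assert (H : prvT T [] cert_A4) by cert_axiom Hc.
  apply prvT_allE with (t := num k) in H; num_simpl_in H.
  eapply prvT_impE; [exact H | apply prvT_andI; auto].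
Qed.

Lemma cert_A5_inst T n i j k : certified T n -> i <= n -> j <= n -> k <= n ->
  prvT T [] (fNot (fEq (tsucc (tadd (tmul (num i) (num j)) (num k))) tzero)).
Proof.
  intros (Hc & Hle & _) Hi Hj Hk. assert (H : prvT T [] cert_A5) by cert_axiom Hc.
  cert_inst H (num i). cert_inst H (num j). cert_inst H (num k). exact H.
Qed.

Lemma cert_A6_inst T n i j k l : certified T n ->
  i <= n -> j <= n -> k <= n -> l <= n ->
  prvT T [] (fImp (fEq (tsucc (tadd (tmul (num i) (num j)) (num k))) (tsucc (num l)))
                  (fEq (tadd (tmul (num i) (num j)) (num k)) (num l))).
Proof.
  intros (Hc & Hle & _) Hi Hj Hk Hl. assert (H : prvT T [] cert_A6) by cert_axiom Hc.
  cert_inst H (num i). cert_inst H (num j). cert_inst H (num k). cert_inst H (num l).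
  exact H.
Qed.

Lemma cert_A7_inst T n i j : certified T n -> i <= n -> j <= n ->
  prvT T [] (fEq (tadd (tmul (num i) (num j)) tzero) (tmul (num i) (num j))).
Proof.
  intros (Hc & Hle & _) Hi Hj. assert (H : prvT T [] cert_A7) by cert_axiom Hc.
  cert_inst H (num i). cert_inst H (num j). exact H.
Qed.

Lemma cert_A8_inst T n i j k : certified T n -> i <= n -> j <= n -> k <= n ->
  prvT T [] (fEq (tadd (tmul (num i) (num j)) (tsucc (num k)))
                 (tsucc (tadd (tmul (num i) (num j)) (num k)))).
Proof.
  intros (Hc & Hle & _) Hi Hj Hk. assert (H : prvT T [] cert_A8) by cert_axiom Hc.
  cert_inst H (num i). cert_inst H (num j). cert_inst H (num k). exact H.
Qed.

Lemma cert_A9_inst T n i : certified T n -> i <= n ->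
  prvT T [] (fEq (tmul (num i) tzero) tzero).
Proof.
  intros (Hc & Hle & _) Hi. assert (H : prvT T [] cert_A9) by cert_axiom Hc.
  cert_inst H (num i). exact H.
Qed.

Lemma cert_A10_inst T n i j : certified T n -> i <= n -> j <= n ->
  prvT T [] (fEq (tmul (num i) (tsucc (num j))) (tadd (tmul (num i) (num j)) (num i))).
Proof.
  intros (Hc & Hle & _) Hi Hj. assert (H : prvT T [] cert_A10) by cert_axiom Hc.
  cert_inst H (num i). cert_inst H (num j). exact H.
Qed.

(** Recursion on [k] through A7 and A8. A8 is used at the predecessor of [k], which explains the
    bound [S n]. The value of the product is a hypothesis because [certified_mul] calls this lemma
    in its own recursion. *)
Lemma certified_mul_add T n i j m k : certified T n -> i <= n -> j <= n ->
  prvT T [] (fEq (tmul (num i) (num j)) (num m)) -> k <= S n ->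
  prvT T [] (fEq (tadd (tmul (num i) (num j)) (num k)) (num (m + k))).
Proof.
  intros HT Hi Hj Hm; induction k as [|k IH]; intros Hk.
  - rewrite Nat.add_0_r. eapply prvT_eq_trans; [eapply cert_A7_inst; eauto | exact Hm].
  - rewrite Nat.add_succ_r. eapply prvT_eq_trans; [eapply cert_A8_inst; eauto; lia|].
    apply prvT_eq_succ, IH; lia.
Qed.

Lemma certified_mul T n i j : certified T n -> i <= n -> j <= S n ->
  prvT T [] (fEq (tmul (num i) (num j)) (num (i * j))).
Proof.
  intros HT Hi; induction j as [|j IH]; intros Hj.
  - rewrite Nat.mul_0_r; eapply cert_A9_inst; eauto.
  - rewrite Nat.mul_succ_r. eapply prvT_eq_trans; [eapply cert_A10_inst; eauto; lia|].
    eapply certified_mul_add; eauto; [lia | apply IH; lia].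
Qed.

(** A7 and A8 speak only of sums whose left summand is a product, so [i] is first rewritten as a
    product. *)
Lemma certified_add T n i j : certified T n -> i <= n -> j <= n ->
  prvT T [] (fEq (tadd (num i) (num j)) (num (i + j))).
Proof.
  intros HT Hi Hj.
  assert (exists e, e <= n /\ i * e = i) as (e & He & E).
  (* The factor 1 must itself be at most [n], which holds if [i] is positive; for [i = 0] the factor
     0 serves. *)
  { destruct i; [exists 0 | exists 1]; lia. }
  pose proof (certified_mul T n i e HT Hi ltac:(lia)) as Hm; rewrite E in Hm.
  eapply prvT_eq_trans.
  - apply prvT_eq_add; [apply prvT_eq_sym, Hm | apply prvT_eqI].
  - eapply certified_mul_add; eauto.
Qed.

(** Division with remainder by [n]. It shows that A5 and A6, stated for [x * y + z], reach every
    number up to [n * n + n]. *)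
Lemma mul_add_decomposition n m : m <= n * n + n ->
  exists i j k, i <= n /\ j <= n /\ k <= n /\ i * j + k = m.
Proof.
  intros Hm; destruct (Nat.eq_dec m (n * n + n)) as [->|Hne].
  (* At the top value the quotient would be [n + 1] for positive [n], so the remainder [n] is used
     instead. *)
  - exists n, n, n; auto.
  - assert (n <> 0) by lia.
    pose proof (Nat.div_mod_eq m n); pose proof (Nat.mod_upper_bound m n).
    exists n, (m / n), (m mod n); repeat split; nia.
Qed.

Lemma certified_decomposition T n i j k : certified T n -> i <= n -> j <= n -> k <= n ->
  prvT T [] (fEq (tadd (tmul (num i) (num j)) (num k)) (num (i * j + k))).
Proof.
  intros; eapply certified_mul_add; eauto; eapply certified_mul; eauto.
Qed.

Lemma certified_succ_neq_zero T n m : certified T n -> m <= n * n + n ->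
  prvT T [] (fNot (fEq (num (S m)) tzero)).
Proof.
  intros HT Hm; destruct (mul_add_decomposition n m Hm) as (i & j & k & Hi & Hj & Hk & <-).
  eapply prvT_neq; [|apply prvT_eqI | eapply cert_A5_inst with (i := i) (j := j) (k := k); eauto].
  apply prvT_eq_succ, prvT_eq_sym; eapply certified_decomposition; eauto.
Qed.

Lemma certified_succ_inj T n m l : certified T n -> m <= n * n + n -> l <= n ->
  prvT T [] (fImp (fEq (num (S m)) (num (S l))) (fEq (num m) (num l))).
Proof.
  intros HT Hm Hl.
  destruct (mul_add_decomposition n m Hm) as (i & j & k & Hi & Hj & Hk & <-).
  pose proof (certified_decomposition T n i j k HT Hi Hj Hk) as Hd.
  apply prvT_impI. eapply prvT_eq_trans; [apply prvT_nil, prvT_eq_sym, Hd|].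
  eapply prvT_impE; [apply prvT_nil; eapply cert_A6_inst; eauto|].
  eapply prvT_eq_trans; [apply prvT_nil, prvT_eq_succ, Hd | apply prvT_hyp; left; auto].
Qed.

(** Successors are stripped from both sides by A6 until one side is zero, and A5 then refutes the
    equation. After one step the left number is at most [n * n + n], the range of the
    decomposition. *)
Lemma certified_neq T n k : certified T n -> forall m,
  m <= S (n * n + n) -> k <= n -> m <> k -> prvT T [] (fNot (fEq (num m) (num k))).
Proof.
  intros HT; induction k as [|k IH]; intros [|m] Hm Hk Hne; try lia.
  - eapply certified_succ_neq_zero; eauto; lia.
  - apply prvT_impI. eapply prvT_impE.
    + apply prvT_nil, (certified_succ_neq_zero T n k); auto; nia.
    + apply prvT_eq_sym, prvT_hyp; left; auto.
  - apply prvT_impI. eapply prvT_impE; [apply prvT_nil, (IH m); lia|].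
    eapply prvT_impE; [|apply prvT_hyp; left; reflexivity].
    apply prvT_nil; eapply certified_succ_inj; eauto; lia.
Qed.

(** * The order below a certified element *)

Lemma bound_ax_lift n : flift (bound_ax n) = bound_ax n.
Proof. apply R0_lift_stable, R0_bound. Qed.

Lemma le_zero_bound : prvT (axiom le_zero_ax) [] (bound_ax 0).
Proof.
  apply prvT_allI; [intros A ->; reflexivity|]. cbn.
  apply (prvT_andE1 _ _ _ (fImp (fEq (tvar 0) tzero) (fLe (tvar 0) tzero))).
  apply (prvT_allE _ _ (fIff (fLe (tvar 0) tzero) (fEq (tvar 0) tzero)) (tvar 0)).
  apply prvT_ax; reflexivity.
Qed.

(** The auxiliary theory consists of two closed formulas, so generalising over the bounded variable
    is allowed here, whereas the certified element may be free in the axioms of [T]. *)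
Lemma le_succ_bound k :
  prvT (fun B => B = le_succ_ax k \/ B = bound_ax k) [] (bound_ax (S k)).
Proof.
  set (U := fun _ => _).
  apply prvT_allI.
  { intros A [->| ->]; [|apply bound_ax_lift].
    unfold flift, le_succ_ax; cbn; rewrite !tsubst_num; auto. }
  cbn [map]; apply prvT_impI.
  assert (H : prvT U [fLe (tvar 0) (num (S k))] (le_succ_ax k))
    by (apply prvT_ax; left; auto).
  apply prvT_allE with (t := tvar 0) in H; num_simpl_in H. apply prvT_andE1 in H.
  cbn [bigor]; eapply prvT_orE;
    [eapply prvT_impE; [exact H | apply prvT_hyp; left; reflexivity] | apply prvT_orI1 | apply prvT_orI2].
  - apply prvT_bound; [apply prvT_ax; right; auto | apply prvT_hyp; left; auto].
  - apply prvT_hyp; left; auto.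
Qed.

Lemma certified_bound T n k : certified T n -> k <= n -> prvT T [] (bound_ax k).
Proof.
  intros (Hc & Hle & Hneq); induction k as [|k IH]; intros Hk.
  - eapply prvT_cut; [|apply le_zero_bound]. intros B ->.
    change (prvT T [] cert_A3); cert_axiom Hc.
  - eapply prvT_cut; [|apply le_succ_bound]. intros B [->| ->]; [|apply IH; lia].
    apply cert_A4_inst; [auto | apply Hle | apply Hneq]; lia.
Qed.

(** Reflexivity comes from A3 at zero and from the equality disjunct of A4 at successors; the other
    disjunct of A4 raises the upper end by one. *)
Lemma certified_le T n i k : certified T n -> i <= k -> k <= n ->
  prvT T [] (fLe (num i) (num k)).
Proof.
  intros (Hc & Hle & Hneq) Hi; induction Hi as [|k Hi IH]; intros Hk; [destruct i as [|i]|].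
  - assert (H : prvT T [] cert_A3) by cert_axiom Hc.
    apply prvT_allE with (t := tzero) in H; num_simpl_in H.
    eapply prvT_impE; [eapply prvT_andE2; exact H | apply prvT_eqI].
  - assert (H : prvT T [] (le_succ_ax i))
      by (apply cert_A4_inst; [auto | apply Hle | apply Hneq]; lia).
    apply prvT_allE with (t := num (S i)) in H; num_simpl_in H.
    eapply prvT_impE; [eapply prvT_andE2; exact H | apply prvT_orI2, prvT_eqI].
  - assert (H : prvT T [] (le_succ_ax k))
      by (apply cert_A4_inst; [auto | apply Hle | apply Hneq]; lia).
    apply prvT_allE with (t := num i) in H; num_simpl_in H.
    eapply prvT_impE; [eapply prvT_andE2; exact H | apply prvT_orI1, IH; lia].
Qed.

Lemma certified_R0_upto T n A : certified T n -> R0_upto n A -> prvT T [] A.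
Proof.
  intros HT []; eauto using certified_add, certified_mul, certified_neq,
    certified_bound, certified_le.
Qed.

(** * Certified pure sentences *)

Lemma inst_sentence_body A a r :
  sentence (fEx A) -> inst A (num a) = fsubst (numsubst (scons a r)) A.
Proof. intros HA; eapply fsubst_ext_below; [exact HA|]. intros [|k] Hk; [auto|lia]. Qed.

(** Index 0 thus serves both as the variable bound by the sentence and as the certified element. *)
Lemma inst_sentence_body_var A : sentence (fEx A) -> inst A (tvar 0) = A.
Proof.
  intros HA; rewrite <- (fsubst_var A) at 2.
  eapply fsubst_ext_below; [exact HA|]. intros [|k] Hk; [auto|lia].
Qed.

Lemma certified_refuted A n :
  pure_1Sigma1_sentence (fEx A) -> Nmodels (fNot (fEx A)) ->
  certified (axiom (fAnd cert A)) n ->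
  prvT (axiom (fAnd cert A)) [] (fNot (fEq (num n) (tvar 0))).
Proof.
  intros (HA & A0 & E & Hd & Hp) Hf HT; injection E as <-.
  (* The default value [n] respects the requirement that all values be at most [n]; only index 0
     matters for [A]. *)
  set (r := scons n (fun _ => n)).
  assert (Hn : prvT (axiom (fAnd cert A)) [] (fNot (inst A (num n)))).
  { destruct (R0_upto_decides_delta0 n A Hd Hp r) as [[Hs _]|[_ H]].
    - intros [|i]; cbn; auto.
    - exfalso; apply (Hf (fun _ => n)); exists n; exact Hs.
    - rewrite (inst_sentence_body A n (fun _ => n)) by auto.
      eapply prvT_cut; [|exact H]. intros B; apply certified_R0_upto; auto. }
  (* If the certified element were [num n], the conjunct [A] of the axiom would transfer to [num n],
     where it is refuted. *)
  apply prvT_impI. eapply prvT_impE; [apply prvT_nil, Hn|].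
  eapply prvT_eqE; [apply prvT_eq_sym, prvT_hyp; left; reflexivity|].
  rewrite inst_sentence_body_var by exact HA.
  eapply prvT_andE2, prvT_ax; reflexivity.
Qed.

(** A1 starts the induction. In the step [certified_refuted] excludes equality with [num n], and A2
    then moves the lower bound to [num (S n)]. *)
Lemma false_sentence_certified A n :
  pure_1Sigma1_sentence (fEx A) -> Nmodels (fNot (fEx A)) ->
  certified (axiom (fAnd cert A)) n.
Proof.
  intros HA Hf; induction n as [|n IH].
  - assert (Hc : prvT (axiom (fAnd cert A)) [] cert)
      by (eapply prvT_andE1, prvT_ax; reflexivity).
    split; [auto|]. split; intros k Hk; [|lia].
    replace k with 0 by lia. change (prvT (axiom (fAnd cert A)) [] cert_A1).
    cert_axiom Hc.
  - pose proof (certified_refuted A n HA Hf IH) as Hn.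
    destruct IH as (Hc & Hle & Hneq); split; [auto|]. split; intros k Hk.
    + destruct (Nat.eq_dec k (S n)) as [->|]; [|apply Hle; lia].
      apply cert_A2_inst; auto.
    + destruct (Nat.eq_dec k n) as [->|]; [auto | apply Hneq; lia].
Qed.

(** The existential witness becomes the free index 0, so the work can be done in the theory with the
    single open axiom [A]. *)
Lemma proves_ex_elim A C :
  flift C = C -> prvT (axiom A) [] C -> proves (axiom (fEx A)) C.
Proof.
  intros HC (D & HD & H); cbn in H. exists [fEx A]; split.
  - intros B [<-|[]]; reflexivity.
  - eapply prv_exE; [apply prv_hyp; left; reflexivity|]. rewrite HC.
    eapply prv_weaken; [exact H|]. intros B HB; left; symmetry; apply HD; auto.
Qed.

Theorem theorem4p5 (sigma0 : form)
  (Hsigma : pure_1Sigma1_sentence (fEx sigma0)) :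
  let sigma := fEx sigma0 in
  let sigma_cert := fEx (fAnd cert sigma0) in
  proves (axiom sigma_cert) sigma /\
  (Nmodels sigma -> proves R0 sigma_cert) /\
  (Nmodels (fNot sigma) -> proves_theory (axiom sigma_cert) R0).
Proof.
  intros sigma sigma_cert. pose proof Hsigma as (HA & A0 & E & Hd & Hp).
  injection E as <-. split; [|split].
  - apply proves_ex_elim.
    + unfold flift; rewrite <- (fsubst_var sigma) at 2.
      eapply fsubst_ext_below; [exact HA | lia].
    + apply prvT_exI with (tvar 0). rewrite inst_sentence_body_var by exact HA.
      eapply prvT_andE2, prvT_ax; reflexivity.
  - intros Hm. destruct (Hm (fun _ => 0)) as [a Ha].
    apply (prvT_exI R0 [] (fAnd cert sigma0) (num a)).
    apply prvT_andI; [apply R0_cert|].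
    change (prvT R0 [] (inst sigma0 (num a))).
    rewrite (inst_sentence_body sigma0 a (fun _ => 0)) by exact HA.
    (* The witness [a] bounds every value of the valuation, so the fragment at [a] decides the
       instance, and truth selects the positive case. *)
    apply prvT_mono with (R0_upto a); [apply R0_upto_R0|].
    destruct (R0_upto_decides_delta0 a sigma0 Hd Hp (scons a (fun _ => 0)))
      as [[_ H]|[H _]]; auto; [|contradiction].
    intros [|i]; cbn; lia.
  - intros Hf A HR. apply proves_ex_elim; [apply R0_lift_stable; auto|].
    (* A single axiom mentions finitely many numerals, so certification up to some [n] suffices. *)
    destruct (R0_R0_upto A HR) as [n Hn].
    apply certified_R0_upto with n; auto. apply false_sentence_certified; auto.
Qed.
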